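(* Let $X\subseteq[\omega]^\omega$ be a tower. Then $X$ contains no uncountable perfect set, i.e. $X$ is thin. In particular, there is no $\mathbf{\Sigma}^1_1$ (analytic) maximal tower.
   Context: For $x,y\in[\omega]^\omega$, $y\subseteq^* x$ means $y\setminus x$ is finite. A tower is a set $X\subseteq[\omega]^\omega$ which is well ordered by the relation $x\le y$ iff $y\subseteq^* x$. A pseudointersection of $X$ is an infinite $z\subseteq\omega$ with $z\subseteq^* x$ for all $x\in X$. A tower is maximal if it has no pseudointersection. *)

(* Defs.v *)
From mathcomp Require Import all_boot.
From mathcomp Require Import wochoice.
From mathcomp Require Import all_classical all_reals all_analysis.
Set Implicit Arguments.
Unset Strict Implicit.
Unset Printing Implicit Defensive.
Local Open Scope classical_set_scope.

Definition supp (x : cantor_space) : set nat := [set n | x n].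

(* Subsets of omega are identified with their characteristic functions, so
   [omega]^omega is a subset of the Cantor space; coerced to a type, it carries
   the induced topology, for which it is a Polish space. *)
Definition infinite_subsets : set cantor_space :=
  [set x | infinite_set (supp x)].

Definition almost_subset (y x : infinite_subsets) : Prop :=
  finite_set (supp (set_val y) `\` supp (set_val x)).

Definition tower_le (x y : infinite_subsets) : bool := `[< almost_subset y x >].

(* [wo_chain] requires every nonempty subset to have a unique minimum, so
   distinct elements of a tower are never equal modulo finite. *)
Definition tower (X : set infinite_subsets) : Prop :=
  wo_chain tower_le [in X].

Definition pseudointersection (X : set infinite_subsets)
    (z : infinite_subsets) : Prop :=
  forall x, X x -> almost_subset z x.

Definition maximal_tower (X : set infinite_subsets) : Prop :=
  tower X /\ ~ exists z, pseudointersection X z.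

Definition thin (T : topologicalType) (X : set T) : Prop :=
  ~ exists P : set T, [/\ perfect_set P, ~ countable P & P `<=` X].

(* Boldface Sigma^1_1: empty or a continuous image of the Baire space; meant
   for T Polish. *)
Definition analytic (T : topologicalType) (X : set T) : Prop :=
  X = set0 \/
  exists f : {ptws nat -> nat} -> T, continuous f /\ range f = X.

(* Main.v *)
(* The heart of the proof is that the image of a closed set F of the Baire space
   under a continuous map f into a tower is countable.  Let B be the set of
   points of F all of whose neighborhoods in F have uncountable image.  Inside
   any neighborhood of a point of B there are smaller neighborhoods U and V of
   points of B such that f(b) is almost included in f(a) for all a in U and b in
   V from B: otherwise a fusion argument produces two points of F whose images
   are almost incomparable.  Since f(V) has more than one point, V contains a
   point of B whose image is strictly above f(U).  Hence the set of elements of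
   the tower lying strictly above the image of some neighborhood of a point of
   B has no minimum, so it is empty, and so is B.

   A closed subset of [omega]^omega is such an image, which gives thinness.  An
   analytic tower is countable, and a countable tower has a pseudointersection. *)
Require Import Defs.
From mathcomp Require Import all_boot.
From mathcomp Require Import wochoice.
From mathcomp Require Import all_classical all_reals all_analysis.
From mathcomp Require Import zify.
Set Implicit Arguments.
Unset Strict Implicit.
Unset Printing Implicit Defensive.
Local Open Scope classical_set_scope.

(** * Initial segments and the product topology *)

Definition agree (T : Type) (n : nat) (a b : nat -> T) : Prop :=
  forall i, (i < n)%N -> a i = b i.

Lemma agree_trans (T : Type) n (a b c : nat -> T) :
  agree n a b -> agree n b c -> agree n a c.
Proof. by move=> ab bc i lt_i_n; rewrite ab ?bc. Qed.

Lemma agree_sym (T : Type) n (a b : nat -> T) : agree n a b -> agree n b a.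
Proof. by move=> ab i /ab. Qed.

Lemma agreeW (T : Type) m n (a b : nat -> T) :
  (m <= n)%N -> agree n a b -> agree m a b.
Proof. by move=> mn ab i im; apply: ab; apply: leq_trans mn. Qed.

(** The filter generated by the sets [agree n a] converges to [a] at each coordinate, hence in the
    product. *)
Lemma nbhs_agree (T : topologicalType) (a : {ptws nat -> T})
    (U : set {ptws nat -> T}) :
  nbhs a U -> exists n, forall b, agree n a b -> U b.
Proof.
pose G : set_system {ptws nat -> T} :=
  filter_from [set: nat] (fun n => [set b | agree n a b]).
have GF : Filter G.
  apply: filter_from_filter; first by exists 0.
  move=> i j _ _; exists (maxn i j) => // b ab.
  by split; apply: agreeW ab; rewrite ?leq_maxl ?leq_maxr.
have cvgG : G --> a.
  apply/cvg_sup => i V [V' [[W oW <-] Wa WV]].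
  apply: filterS WV _; exists i.+1 => // b /(_ i (ltnSn i)) abi.
  by move: Wa; rewrite /= -abi.
by move=> /cvgG [n _ nU]; exists n.
Qed.

Lemma agree_nbhs (T : discreteTopologicalType) (a : {ptws nat -> T}) n :
  nbhs a [set b : {ptws nat -> T} | agree n a b].
Proof.
have nbhsF : Filter (nbhs a) := nbhs_filter a.
elim: n => [|n IHn]; first by apply: filterS filterT => b _ i.
have an : nbhs a [set b : {ptws nat -> T} | b n = a n].
  exact: (@proj_continuous nat (fun=> T) n a [set a n] (discrete_set1 _)).
apply: filterS2 IHn an => b ab abn i; rewrite ltnS leq_eqVlt.
by move=> /predU1P[->|/ab].
Qed.

(** * Almost inclusion and the tower order *)

Lemma infinite_natP (A : set nat) :
  infinite_set A <-> forall n, exists2 m, (n <= m)%N & A m.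
Proof.
split=> [Ainf n|Aunb /finite_seqP [s As]].
  apply: contrapT => nA; apply: Ainf; apply: (sub_finite_set _ (finite_II n)).
  move=> m Am /=; rewrite ltnNge; apply/negP => nm; by apply: nA; exists m.
have [m] := Aunb (\max_(i <- s) i).+1.
by rewrite As /= ltnNge => /negP nm ms; apply: nm; exact: leq_bigmax_seq.
Qed.

Lemma almost_subsetP (y x : infinite_subsets) :
  almost_subset y x <->
  exists n, forall m, (n <= m)%N -> set_val y m -> set_val x m.
Proof.
rewrite /almost_subset /supp; split=> [fin|[n nyx]].
  apply: contrapT => nyx; move: fin; apply/infinite_natP => n.
  apply: contrapT => nm; apply: nyx; exists n => m le_n_m ym.
  by apply: contrapT => nxm; apply: nm; exists m.
by apply: contrapT => /infinite_natP/(_ n)[m nm [ym]]; apply; exact: nyx ym.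
Qed.

Lemma almost_subset_trans (z y x : infinite_subsets) :
  almost_subset z y -> almost_subset y x -> almost_subset z x.
Proof.
move=> /almost_subsetP[n zy] /almost_subsetP[k yx].
apply/almost_subsetP; exists (maxn n k) => m; rewrite geq_max => /andP[nm km].
by move=> /(zy _ nm)/(yx _ km).
Qed.

Lemma infinite_subsets_unbounded (x : infinite_subsets) n :
  exists2 m, (n <= m)%N & set_val x m.
Proof. by have /infinite_natP := set_valP x; apply. Qed.

Lemma continuous_coord (f : {ptws nat -> nat} -> infinite_subsets) a m :
  continuous f ->
  exists n, forall b, agree n a b -> set_val (f b) m = set_val (f a) m.
Proof.
move=> fc; apply: nbhs_agree.
apply: (fc a [set y | set_val y m = set_val (f a) m]).
apply: (@initial_continuous _ _ (set_val : infinite_subsets -> cantor_space)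
  (f a) [set y : cantor_space | y m = set_val (f a) m]).
exact: (@proj_continuous nat (fun=> bool) m _ [set _] (discrete_set1 _)).
Qed.

Lemma continuous_agree (f : {ptws nat -> nat} -> infinite_subsets) :
  (forall a n, exists k, forall b, agree k a b ->
     agree n (set_val (f a)) (set_val (f b))) ->
  continuous f.
Proof.
move=> fagree; apply: continuous_comp_initial => a U /nbhs_agree [n nU].
have [k kn] := fagree a n.
by apply: filterS (agree_nbhs a k) => b /kn; apply: nU.
Qed.

Lemma tower_total (X : set infinite_subsets) x y :
  tower X -> X x -> X y -> almost_subset x y \/ almost_subset y x.
Proof.
move=> /wo_chainW Xtot /mem_set Xx /mem_set Xy.
by have /orP[/asboolP|/asboolP] := Xtot y x Xy Xx; [left|right].
Qed.

Lemma tower_anti (X : set infinite_subsets) x y :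
  tower X -> X x -> X y -> almost_subset x y -> almost_subset y x -> x = y.
Proof.
move=> /wo_chain_antisymmetric Xanti /mem_set Xx /mem_set Xy xy yx.
by apply: (Xanti x y Xx Xy); apply/andP; split; apply/asboolP.
Qed.

Lemma tower_min (X S : set infinite_subsets) :
  tower X -> S `<=` X -> S !=set0 ->
  exists2 w, S w & forall y, S y -> almost_subset y w.
Proof.
move=> Xwo SX [s Ss].
have [||w [[/set_mem Sw wmin] _]] := Xwo [in S].
- by move=> x /set_mem/SX/mem_set.
- by exists s; apply/mem_set.
by exists w => // y /mem_set/wmin/asboolP.
Qed.

(** * Condensation points *)

Definition condensation (F : set (nat -> nat))
    (f : (nat -> nat) -> infinite_subsets) : set (nat -> nat) :=
  [set a | F a /\ forall n, ~ countable (f @` (F `&` agree n a))].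

Section condensation.
Variables (F : set (nat -> nat)) (f : (nat -> nat) -> infinite_subsets).
Let B := condensation F f.

(** Basic neighborhoods are coded by finite sequences, so countably many of those with countable
    image cover [F] off [B]. *)
Lemma countable_off_condensation : countable (f @` (F `\` B)).
Proof.
pose small (s : seq nat) := [set a | F a /\ agree (size s) a (nth 0 s)].
pose D := [set s | countable (f @` small s)].
suff : f @` (F `\` B) `<=` \bigcup_(s in D) (f @` small s).
  by move=> /subset_card_le/sub_countable; apply; apply: bigcup_countable.
move=> _ [a [Fa nBa] <-].
have [n cn] : exists n, countable (f @` (F `&` agree n a)).
  by apply: contrapT => /forallNP nc; apply: nBa.
have an : agree n a (nth 0 (mkseq a n)) by move=> i i_n; rewrite nth_mkseq.
exists (mkseq a n); last by exists a => //; split=> //; rewrite size_mkseq.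
rewrite /D /small/= size_mkseq; apply: sub_countable cn; apply: subset_card_le.
move=> _ [b [Fb bn] <-]; exists b => //; split=> //.
exact: agree_trans an (agree_sym bn).
Qed.

Lemma condensation_uncountable a n :
  B a -> ~ countable (f @` (B `&` agree n a)).
Proof.
move=> [_ /(_ n) unc] cnt; apply: unc.
have : countable (f @` (B `&` agree n a) `|` f @` (F `\` B)).
  rewrite -bigcup2E; apply: bigcup_countable => // -[|[|i]] _ //=.
  exact: countable_off_condensation.
apply/sub_countable/subset_card_le => _ [b [Fb ab] <-].
by have [Bb|nBb] := pselect (B b); [left|right]; exists b.
Qed.

Lemma condensation_nonempty : ~ countable (f @` F) -> B !=set0.
Proof.
move=> unc; apply: contrapT => B0; apply: unc.
apply: sub_countable countable_off_condensation; apply: subset_card_le.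
by apply: image_subset => a Fa; split=> // Ba; apply: B0; exists a.
Qed.

End condensation.

(** * Fusion to an incomparable pair *)

Section fusion.
Variables (F D : set {ptws nat -> nat}).
Variable f : {ptws nat -> nat} -> infinite_subsets.
Hypotheses (Fclosed : closed F) (fcont : continuous f) (DF : D `<=` F).

(** The witness [m] against almost inclusion depends only on the first [n] values, so it survives
    all later refinements. *)
Let escapes n a b m :=
  forall c d, agree n a c -> agree n b d ->
    set_val (f d) m /\ ~~ set_val (f c) m.

Let separable := forall n a b, D a -> D b ->
  exists a' b', [/\ D a', D b', agree n a a', agree n b b' &
                    ~ almost_subset (f b') (f a')].

Lemma escape n a b : separable -> D a -> D b ->
  exists a' b' n', [/\ D a', D b', agree n a a', agree n b b' &
    (n <= n')%N /\ exists2 m, (n <= m)%N & escapes n' a' b' m].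
Proof.
move=> sepD Da Db; have [a' [b' [Da' Db' aa' bb' nab]]] := sepD n a b Da Db.
have [m nm [fbm fam]] :
    exists2 m, (n <= m)%N & set_val (f b') m /\ ~~ set_val (f a') m.
  apply: contrapT => nom; apply: nab; apply/almost_subsetP.
  exists n => m nm fbm.
  by apply: contrapT => /negP fam; apply: nom; exists m.
have [k ak] := continuous_coord a' m fcont.
have [l bl] := continuous_coord b' m fcont.
exists a', b', (maxn n (maxn k l)); split=> //.
split; [exact: leq_maxl | exists m => // c d ac bd].
by rewrite (ak c) ?(bl d) //; [apply: agreeW bd | apply: agreeW ac]; lia.
Qed.

(** A state is a pair of points of [D] with the length of the initial segments already frozen.
    Membership in [D] is part of the type, as dependent choice runs over a type. *)
Let step (p q : {p : {ptws nat -> nat} * {ptws nat -> nat} * nat |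
    D p.1.1 /\ D p.1.2}) :=
  let: (a, b, n) := sval p in let: (a', b', n') := sval q in
  [/\ agree n a a', agree n b b', (n < n')%N,
      exists2 m, (n <= m)%N & escapes n' a' b' m &
      exists2 m, (n <= m)%N & escapes n' b' a' m].

Lemma step_exists p : separable -> exists q, step p q.
Proof.
case: p => [[[a b] n] /= [Da Db]] sepD.
have [a1 [b1 [k [Da1 Db1 aa1 bb1 [nk [m nm abm]]]]]] := escape n sepD Da Db.
have [b2 [a2 [l [Db2 Da2 bb2 aa2 [kl [m' km bam]]]]]] := escape k sepD Db1 Da1.
exists (exist _ (a2, b2, l.+1) (conj Da2 Db2)); split => //=.
- exact: agree_trans aa1 (agreeW nk aa2).
- exact: agree_trans bb1 (agreeW nk bb2).
- by rewrite ltnS (leq_trans nk).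
- exists m => // c d ac bd; apply: abm.
    by apply: agree_trans aa2 _; apply: agreeW ac; lia.
  by apply: agree_trans bb2 _; apply: agreeW bd; lia.
- exists m'; first exact: leq_trans km.
  by move=> c d bc ad; apply: bam; [apply: agreeW bc | apply: agreeW ad].
Qed.

(* The limits of the first and second components of the states built by [step]
   differ in both directions at infinitely many coordinates. *)
Lemma fusion : separable -> D !=set0 -> exists a b, [/\ F a, F b,
  ~ almost_subset (f b) (f a) & ~ almost_subset (f a) (f b)].
Proof.
move=> sepD [a0 Da0].
have stepE p : {q | step p q} by apply: cid; exact: step_exists.
have [u [_ uS]] := dependent_choice stepE (exist _ (a0, a0, 0) (conj Da0 Da0)).
pose a k := (sval (u k)).1.1; pose b k := (sval (u k)).1.2.
pose N k := (sval (u k)).2.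
have {}uS k : [/\ agree (N k) (a k) (a k.+1), agree (N k) (b k) (b k.+1),
    (N k < N k.+1)%N,
    exists2 m, (N k <= m)%N & escapes (N k.+1) (a k.+1) (b k.+1) m &
    exists2 m, (N k <= m)%N & escapes (N k.+1) (b k.+1) (a k.+1) m].
  rewrite /a /b /N; move: (uS k); rewrite /step.
  by case: (sval (u k)) => [[? ?] ?]; case: (sval (u k.+1)) => [[? ?] ?].
have Dab k : D (a k) /\ D (b k) by rewrite /a /b; case: (u k).
have kN k : (k <= N k)%N.
  by elim: k => // k IHk; have [_ _ + _ _] := uS k; apply: leq_ltn_trans.
(* Coordinate [i] is frozen from stage [i.+1] on, because [i < i.+1 <= N i.+1]; the diagonal thus
   reads off the limit. *)
have limit (c : nat -> {ptws nat -> nat}) :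
    (forall k, agree (N k) (c k) (c k.+1)) ->
    forall k, agree (N k) (c k) (fun i => c i.+1 i).
  move=> cS.
  have mono k j : agree (N k) (c k) (c (k + j)%N) /\ (N k <= N (k + j))%N.
    elim: j => [|j [IHc IHN]]; first by rewrite addn0.
    rewrite addnS; have [_ _ ltN _ _] := uS (k + j)%N.
    split; last by rewrite ltnW // (leq_ltn_trans IHN).
    by apply: agree_trans IHc _; apply: agreeW (cS _).
  move=> k i iN; have [ki|ik] := leqP k i.
    by have [+ _] := mono k (i.+1 - k)%N; rewrite subnKC ?(leqW ki) //; apply.
  have [+ _] := mono i.+1 (k - i.+1)%N; rewrite subnKC // => /(_ i) -> //.
have aS k : agree (N k) (a k) (a k.+1) by have [] := uS k.
have bS k : agree (N k) (b k) (b k.+1) by have [] := uS k.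
have Flimit (c : nat -> {ptws nat -> nat}) :
    (forall k, D (c k)) -> (forall k, agree (N k) (c k) (c k.+1)) ->
    F (fun i => c i.+1 i).
  move=> Dc cS; apply: Fclosed => U /nbhs_agree [n nU].
  exists (c n); split; first exact/DF.
  by apply: nU; apply: agreeW (kN n) (agree_sym (limit c cS n)).
exists (fun i => a i.+1 i), (fun i => b i.+1 i); split.
- by apply: Flimit => // k; have [] := Dab k.
- by apply: Flimit => // k; have [] := Dab k.
(* Stage [n] defeats the bound [n]: its witness is at least [N n], hence at least [n]. *)
- move=> /almost_subsetP[n nba]; have [_ _ _ [m nm esc] _] := uS n.
  have [fb /negP] := esc _ _ (limit a aS n.+1) (limit b bS n.+1); apply.
  by apply: nba fb; exact: leq_trans nm.
- move=> /almost_subsetP[n nab]; have [_ _ _ _ [m nm esc]] := uS n.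
  have [fa /negP] := esc _ _ (limit b bS n.+1) (limit a aS n.+1); apply.
  by apply: nab fa; exact: leq_trans nm.
Qed.

End fusion.

(** * Countability of closed images inside a tower *)

Section tower_image.
Variables (X : set infinite_subsets) (F : set {ptws nat -> nat}).
Variable f : {ptws nat -> nat} -> infinite_subsets.
Hypotheses (Xtower : tower X) (Fclosed : closed F) (fcont : continuous f).
Hypothesis fFX : f @` F `<=` X.
Let B : set {ptws nat -> nat} := condensation F f.

(** Fusion is applied to the points of [B] near [a0]. Its limits need only lie in [F], since [f]
    maps all of [F] into the tower. *)
Lemma ordered_neighborhoods a0 n0 : B a0 ->
  exists a b n, [/\ B a, B b, agree n0 a0 a, agree n0 a0 b & (n0 <= n)%N /\
    forall a' b', B a' -> B b' -> agree n a a' -> agree n b b' ->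
      almost_subset (f b') (f a')].
Proof.
move=> Ba0; apply: contrapT => nord.
have [|||a [b [Fa Fb nba nab]]] :=
    @fusion F (B `&` agree n0 a0) f Fclosed fcont.
- by move=> a [[]].
- move=> n a b [Ba a0a] [Bb a0b]; apply: contrapT => nsep; apply: nord.
  exists a, b, (maxn n0 n); split=> //; split; first exact: leq_maxl.
  move=> a' b' Ba' Bb' aa' bb'; apply: contrapT => nba; apply: nsep.
  exists a', b'; split=> //.
  + split=> //; apply: agree_trans a0a _; apply: agreeW aa'; exact: leq_maxl.
  + split=> //; apply: agree_trans a0b _; apply: agreeW bb'; exact: leq_maxl.
  + by apply: agreeW aa'; exact: leq_maxr.
  + by apply: agreeW bb'; exact: leq_maxr.
- by exists a0.
by case: (tower_total Xtower (fFX (imageP f Fa)) (fFX (imageP f Fb))).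
Qed.

(** Higher in the tower means almost included, so [w] is the almost smaller set here. *)
Let above w := exists a n, B a /\
  forall a', B a' -> agree n a a' -> almost_subset w (f a') /\ f a' <> w.

Lemma above_in_neighborhood a n :
  B a -> exists b, [/\ B b, agree n a b & above (f b)].
Proof.
move=> /(ordered_neighborhoods n)[c [d [k [Bc Bd ac ad [nk ord]]]]].
have fX b : B b -> X (f b) by move=> [Fb _]; exact/fFX/imageP.
(* The image near [d] is uncountable, so some value there differs from [f d]; the two are
   comparable. *)
have [b1 [b2 [Bb1 Bb2 db1 db2 [f21 f12]]]] : exists b1 b2, [/\ B b1, B b2,
    agree k d b1, agree k d b2 & almost_subset (f b2) (f b1) /\ f b1 <> f b2].
  apply: contrapT => nb; apply: (@condensation_uncountable F f d k Bd).
  apply: sub_countable (countable1 (f d)); apply: subset_card_le.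
  move=> _ [b [Bb db] <-] /=; apply: contrapT => fbd.
  have [fle|fle] := tower_total Xtower (fX b Bb) (fX d Bd); apply: nb.
    by exists d, b; split=> //; split=> // /esym.
  by exists b, d; split.
exists b2; split=> //; first exact: agree_trans ad (agreeW nk db2).
exists c, k; split=> // a' Ba' ca'; split; first exact: ord.
(* If [f a'] were [f b2], the ordering of the neighborhoods would make [f b1] almost included in
   [f b2], so the two would coincide. *)
move=> fa'; apply: f12; apply: (tower_anti Xtower (fX _ Bb1) (fX _ Bb2) _ f21).
by rewrite -fa'; apply: ord.
Qed.

Lemma countable_tower_image : countable (f @` F).
Proof.
apply: contrapT => /condensation_nonempty [a0 Ba0].
pose S := [set w | X w /\ above w].
have [||w Sw wmin] := @tower_min X S Xtower.
- by move=> w [].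
- have [b [Bb _ abv]] := above_in_neighborhood 0 Ba0.
  by exists (f b); split=> //; apply/fFX/imageP; case: Bb.
have [_ [a [n [Ba aw]]]] := Sw.
(* Near [a] all values on [B] are strictly below [w], yet one of them, [f b], is again in [S],
   against minimality. *)
have [b [Bb ab abv]] := above_in_neighborhood n Ba.
have Xfb : X (f b) by apply/fFX/imageP; case: Bb.
have [wfb] := aw b Bb ab; apply.
have Xw : X w by apply: (proj1 Sw).
by apply: (tower_anti Xtower Xfb Xw _ wfb); apply: wmin.
Qed.

End tower_image.

(** * Pseudointersections of countable towers *)

(** Diagonalize: enumerate the tower by [g], pick [u n >= n] in all of [g 0], ..., [g n], and take
    the range of [u]. *)
Lemma countable_tower_pseudointersection (X : set infinite_subsets) :
  tower X -> countable X -> exists z, pseudointersection X z.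
Proof.
have [-> _ _|/set0P [x0 Xx0] Xtower cX] := eqVneq X set0.
  have inf : infinite_subsets (fun=> true).
    by apply/infinite_natP => n; exists n.
  by exists (exist (fun x => x \in infinite_subsets) _ (mem_set inf)).
have [h hinj] := countable_injP _ cX.
(* [g] inverts the injection [h], with default value [x0] off its range. *)
have gE n : exists x, X x /\ forall y, X y -> h y = n -> x = y.
  have [[y Xy hyn]|noy] := pselect (exists2 y, X y & h y = n).
    exists y; split=> // z Xz hzn.
    by apply: hinj; rewrite ?hyn //; apply/mem_set.
  by exists x0; split=> // y Xy hyn; case: noy; exists y.
pose g n := sval (cid (gE n)).
have gP n : X (g n) /\ forall y, X y -> h y = n -> g n = y.
  by rewrite /g; case: cid.
have gX i : X (g i) by have [] := gP i.
have almost_refl x : almost_subset x x by apply/almost_subsetP; exists 0.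
(* The highest of finitely many tower elements is almost included in the others. *)
have low n : exists w, X w /\ forall i, (i <= n)%N -> almost_subset w (g i).
  elim: n => [|n [w [Xw wle]]].
    by exists (g 0); split=> // i; rewrite leqn0 => /eqP ->.
  have [wg|gw] := tower_total Xtower Xw (gX n.+1).
    by exists w; split=> // i; rewrite leq_eqVlt => /predU1P[->|/wle].
  exists (g n.+1); split=> // i; rewrite leq_eqVlt => /predU1P[->//|/wle wi].
  exact: almost_subset_trans gw wi.
have common n : exists2 k, (n <= k)%N & forall i, (i <= n)%N -> set_val (g i) k.
  have [w [_ wle]] := low n.
  have [r wr] : exists r, forall i, (i <= n)%N ->
      forall k, (r <= k)%N -> set_val w k -> set_val (g i) k.
    elim: n wle {Xtower} => [|n IHn] wle.
      have /almost_subsetP[r wr] := wle 0 (leqnn 0).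
      by exists r => i; rewrite leqn0 => /eqP ->.
    have [i /leqW /wle //|r wr] := IHn.
    have /almost_subsetP[r' wr'] := wle n.+1 (leqnn _).
    exists (maxn r r') => i + k; rewrite geq_max => + /andP[rk r'k].
    rewrite leq_eqVlt => /predU1P[->|i_n]; first exact: wr'.
    exact: (wr i i_n k rk).
  have [k] := infinite_subsets_unbounded w (maxn n r).
  rewrite geq_max => /andP[nk rk] wk.
  by exists k => // i i_n; apply: wr wk.
pose u n := sval (cid2 (common n)).
have le_u n : (n <= u n)%N by rewrite /u; case: cid2.
have gu n i : (i <= n)%N -> set_val (g i) (u n).
  by rewrite /u; case: cid2 => k nk; apply.
pose z : cantor_space := fun m => `[< exists n, u n = m >].
have zinf : infinite_subsets z.
  apply/infinite_natP => n; exists (u n); first exact: le_u.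
  by apply/asboolP; exists n.
exists (exist (fun x => x \in infinite_subsets) z (mem_set zinf)) => x Xx.
have <- : g (h x) = x by apply: (proj2 (gP (h x))).

(* Only the points [u n] with [n < h x] may miss [x], and the bound exceeds them all. *)
apply/almost_subsetP; exists (\max_(n < h x) u n).+1 => m um.
rewrite set_valE /= => /asboolP[n unm]; rewrite -unm; apply: gu.
rewrite leqNgt; apply/negP => nhx; move: um.
rewrite ltnNge -unm => /negP; apply.
exact: (leq_bigmax (Ordinal nhx)).
Qed.

(** * The infinite sets as a continuous image of the Baire space *)

(* As [a] varies, [shift_set a] runs through all infinite sets: [a] may send n
   to the distance from n to the next element. *)
Definition shift_set (a : {ptws nat -> nat}) : cantor_space :=
  fun m => [exists n : 'I_m.+1, n + a n == m]%N.

Lemma shift_setP a m : reflect (exists n, n + a n = m)%N (shift_set a m).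
Proof.
apply: (iffP existsP) => [[n /eqP nm]|[n nm]]; first by exists n.
have n_lt : (n < m.+1)%N by rewrite ltnS -nm leq_addr.
by exists (Ordinal n_lt); rewrite /= nm.
Qed.

Lemma shift_set_infinite a : infinite_subsets (shift_set a).
Proof.
apply/infinite_natP => n; exists (n + a n)%N; first exact: leq_addr.
by apply/shift_setP; exists n.
Qed.

Definition shift (a : {ptws nat -> nat}) : infinite_subsets :=
  exist (fun x => x \in infinite_subsets) (shift_set a)
    (mem_set (@shift_set_infinite a)).

(** Membership of [m] involves only the values of [a] at arguments up to [m]. *)
Lemma shift_continuous : continuous shift.
Proof.
apply: continuous_agree => a n; exists n => b ab m mn.
rewrite !set_valE /=; apply: eq_existsb => i.
by rewrite ab // (leq_trans (ltn_ord i)).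
Qed.

Lemma shift_surjective x : exists a, shift a = x.
Proof.
have xn n : exists m, (n <= m)%N && set_val x m.
  by have [m nm xm] := infinite_subsets_unbounded x n; exists m; rewrite nm.
exists (fun n => ex_minn (xn n) - n)%N.
apply: val_inj; apply: funext => m.
apply/shift_setP/idP => [[n <-]|xm].
  by case: ex_minnP => k /andP[nk xk] _; rewrite subnKC.
(* For [m] in [x] the next element from [m] is [m] itself, at distance 0. *)
exists m; case: ex_minnP => k /andP[mk _] /(_ m); rewrite leqnn => /(_ xm) km.
by rewrite subnKC //; apply/eqP; rewrite eqn_leq mk km.
Qed.

Theorem theorem2p2 :
  (forall X : set infinite_subsets, tower X -> thin X) /\
  ~ exists X : set infinite_subsets, analytic X /\ maximal_tower X.
Proof.
split=> [X Xtower [P [[Pclosed _] Pncount PX]]|[X [Xan [Xtower]]]].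
  apply: Pncount; have -> : P = shift @` (shift @^-1` P).
    apply/seteqP; split=> [x Px|_ [a Pa <-] //].
    by have [a ax] := shift_surjective x; exists a; rewrite //= ax.
  apply: (countable_tower_image Xtower _ shift_continuous).
    by apply: closed_comp => // a _; exact: shift_continuous.
  by move=> _ [a Pa <-]; exact: PX.
apply; apply: countable_tower_pseudointersection => //.
have [->|[f [fcont fX]]] := Xan; first exact: countable0.
by rewrite -fX; apply: (countable_tower_image Xtower closedT fcont); rewrite fX.
Qed.
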